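(* Let $S$ be a finite set with $|S| \geq 2$ and let $X = F^R(S)$ be the free rack on $S$. Then the second bounded rack cohomology $H_{\mathrm{b}}^2(X, \mathbb{R})$ is infinite-dimensional as a real vector space.
   Context: A rack is a set $X$ with a binary operation $\triangleleft \colon X \times X \to X$ such that $(x \triangleleft y) \triangleleft z = (x \triangleleft z) \triangleleft (y \triangleleft z)$ for all $x,y,z \in X$, and for every $y \in X$ the map $x \mapsto x \triangleleft y$ is bijective. The free rack on a set $S$ is $F^R(S) = S \times F^G(S)$, where $F^G(S)$ is the free group on $S$, with operation $(s, g) \triangleleft (t, h) = (s, g h^{-1} t h)$. Its rank is $|S|$. Bounded rack cohomology: for $n \geq 0$ let $C^n_{\mathrm{b}}(X; \mathbb{R})$ be the real vector space of bounded functions $X^n \to \mathbb{R}$ ($X^0$ a one-point set). For $n \ge 1$ let $\delta^n \colon C^n_{\mathrm{b}} \to C^{n+1}_{\mathrm{b}}$ be $$\delta^n f(x_1, \dots, x_{n+1}) = \sum_{i=1}^{n+1} (-1)^i \left[ f(x_1, \dots, x_{i-1}, x_{i+1}, \dots, x_{n+1}) - f(x_1 \triangleleft x_i, \dots, x_{i-1} \triangleleft x_i, x_{i+1}, \dots, x_{n+1}) \right],$$ and $\delta^n = 0$ for $n \leq 0$. Then $H^n_{\mathrm{b}}(X, \mathbb{R}) = \ker \delta^n / \operatorname{im} \delta^{n-1}$ for this complex of bounded cochains. In particular $\delta^1 f(x,y) = f(x) - f(x \triangleleft y)$. *)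

(* Defs.v *)
From HB Require Import structures.
From mathcomp Require Import all_boot all_order all_algebra.
From mathcomp Require Import zify ring lra.
From mathcomp Require Import all_classical all_reals all_analysis.

Set Implicit Arguments.
Unset Strict Implicit.
Unset Printing Implicit Defensive.

Import Order.TTheory GRing.Theory Num.Theory.
Import numFieldNormedType.Exports.

Reserved Notation "x ◁ y" (at level 40, left associativity).

HB.mixin Record isRack (X : Type) := {
  rack_op : X -> X -> X;
  rack_opD : forall x y z,
    rack_op (rack_op x y) z = rack_op (rack_op x z) (rack_op y z);
  rack_op_bij : forall y, bijective (rack_op^~ y)
}.

#[short(type="rackType")]
HB.structure Definition Rack := {X of isRack X}.

Declare Scope rack_scope.
Delimit Scope rack_scope with rack.
Notation "x ◁ y" := (rack_op x y) : rack_scope.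

(* The free group on S, realised as the reduced words in the letters           *)
(* (s, false) = s and (s, true) = s^-1.                                        *)
Section FreeGroup.
Variable S : choiceType.

Definition letter_inv (x : S * bool) : S * bool := (x.1, ~~ x.2).

Definition reduced : pred (seq (S * bool)) :=
  sorted (fun x y => y != letter_inv x).

Record free_group := FreeGroup { word :> seq (S * bool); _ : reduced word }.

HB.instance Definition _ := [isSub for word].
HB.instance Definition _ := [Choice of free_group by <:].

(* The reduced form of x :: w, for w reduced.                                  *)
Definition letter_mul (x : S * bool) (w : seq (S * bool)) :=
  if w is y :: w' then if y == letter_inv x then w' else x :: w else [:: x].

Definition word_mul (v w : seq (S * bool)) := foldr letter_mul w v.

Lemma letter_invK : involutive letter_inv.
Proof. by case=> s b; rewrite /letter_inv /= negbK. Qed.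

Lemma reduced_letter_mul x w : reduced w -> reduced (letter_mul x w).
Proof.
case: w => [//|y w] /= rw; case: ifPn => [_|yx]; first exact: path_sorted rw.
by rewrite /= yx.
Qed.

Lemma reduced_word_mul v w : reduced w -> reduced (word_mul v w).
Proof. by move=> rw; elim: v => //= x v; apply: reduced_letter_mul. Qed.

Lemma letter_mulK x w :
  reduced w -> letter_mul x (letter_mul (letter_inv x) w) = w.
Proof.
case: w => [|y w] /=; first by rewrite eqxx.
rewrite letter_invK; case: eqP => [->|yx]; last by rewrite /= eqxx.
by case: w => [//|z w] /= /andP[/negPf->].
Qed.

Lemma letter_mulVK x w :
  reduced w -> letter_mul (letter_inv x) (letter_mul x w) = w.
Proof. by move=> rw; rewrite -{2}(letter_invK x) letter_mulK. Qed.

Lemma word_mul_letter x v w : reduced v -> reduced w ->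
  word_mul (letter_mul x v) w = letter_mul x (word_mul v w).
Proof.
case: v => [//|y v] /= rv rw; case: eqP => [->|//].
by rewrite letter_mulK // reduced_word_mul.
Qed.

Lemma word_mulA u v w : reduced v -> reduced w ->
  word_mul u (word_mul v w) = word_mul (word_mul u v) w.
Proof.
move=> rv rw; elim: u => //= x u ->.
by rewrite word_mul_letter // reduced_word_mul.
Qed.

Lemma word_mul1 w : reduced w -> word_mul w [::] = w.
Proof.
elim: w => //= x w IHw rw; rewrite IHw; last exact: path_sorted rw.
by case: w rw {IHw} => //= y w /andP[/negPf->].
Qed.

Definition word_inv (w : seq (S * bool)) := rev (map letter_inv w).

Lemma reduced_word_inv w : reduced w -> reduced (word_inv w).
Proof.
rewrite /reduced /word_inv rev_sorted sorted_map.
apply: sub_sorted w => x y /=.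
by rewrite (inj_eq (inv_inj letter_invK)) eq_sym (inv_eq letter_invK) eq_sym.
Qed.

Lemma word_mulVr w u : reduced u -> word_mul (word_inv w) (word_mul w u) = u.
Proof.
move=> ru; elim: w => //= x w IHw.
rewrite /word_inv /= rev_cons -cats1 /word_mul foldr_cat /=.
by rewrite letter_mulVK ?reduced_word_mul.
Qed.

Lemma word_invK : involutive word_inv.
Proof.
by move=> w; rewrite /word_inv map_rev revK -map_comp (eq_map letter_invK) map_id.
Qed.

Definition fg_one := FreeGroup (isT : reduced [::]).
Definition fg_mul (v w : free_group) :=
  FreeGroup (reduced_word_mul v (valP w)).
Definition fg_inv (w : free_group) := FreeGroup (reduced_word_inv (valP w)).

Lemma fg_mulA : associative fg_mul.
Proof. by move=> u v w; apply/val_inj/word_mulA; apply: valP. Qed.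

Lemma fg_mul1g : left_id fg_one fg_mul.
Proof. by move=> w; apply/val_inj. Qed.

Lemma fg_mulg1 : right_id fg_one fg_mul.
Proof. by move=> w; apply/val_inj/word_mul1/valP. Qed.

Lemma fg_mulVg : left_inverse fg_one fg_inv fg_mul.
Proof.
move=> w; apply/val_inj => /=.
by rewrite -{2}(word_mul1 (valP w)) word_mulVr.
Qed.

Lemma fg_mulgV : right_inverse fg_one fg_inv fg_mul.
Proof.
move=> w; apply/val_inj => /=.
have rw : reduced (word_inv w) by apply/reduced_word_inv/valP.
by have := word_mulVr (word_inv w) (isT : reduced [::]); rewrite word_invK word_mul1.
Qed.

HB.instance Definition _ :=
  isGroup.Build free_group fg_mulA fg_mul1g fg_mulg1 fg_mulVg fg_mulgV.

Definition fg_gen (s : S) : free_group :=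
  FreeGroup (isT : reduced [:: (s, false)]).

End FreeGroup.

Section FreeRack.
Variable S : choiceType.
Local Open Scope group_scope.

Definition free_rack := (S * free_group S)%type.

Definition free_rack_op (x y : free_rack) : free_rack :=
  (x.1, x.2 * y.2^-1 * fg_gen y.1 * y.2).

Lemma free_rack_opD x y z :
  free_rack_op (free_rack_op x y) z =
  free_rack_op (free_rack_op x z) (free_rack_op y z).
Proof.
by rewrite /free_rack_op /=; congr pair; rewrite !invgM !invgK !mulgA !mulgK !mulgVK.
Qed.

Lemma free_rack_op_bij y : bijective (free_rack_op^~ y).
Proof.
exists (fun x => (x.1, x.2 * y.2^-1 * (fg_gen y.1)^-1 * y.2)) => -[s g];
  by rewrite /free_rack_op /= ?(mulgK, mulgVK).
Qed.

HB.instance Definition _ :=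
  isRack.Build free_rack free_rack_opD free_rack_op_bij.

End FreeRack.

Local Open Scope ring_scope.

Section QuotientModule.
Variables (K : pzRingType) (V : lmodType K) (I : submodClosed V).
Local Open Scope quotient_scope.

(* A copy of I: submodClosed, which also exists over semirings, does not       *)
(* provide the closure under opposites that Quotient.quot requires.            *)
Definition submod_pred : {pred V} := I.

Lemma submod_pred_zmod_closed : zmod_closed submod_pred.
Proof. exact/GRing.submod_closedB/submodClosedP. Qed.

HB.instance Definition _ := GRing.isZmodClosed.Build V submod_pred
  submod_pred_zmod_closed.

Definition quot_module := Quotient.quot submod_pred.
Local Notation Q := quot_module.

HB.instance Definition _ := ZmodQuotient.on Q.

Definition quot_scale (a : K) : Q -> Q := lift_op1 Q ( *:%R a).

Lemma pi_scale a (x : V) : \pi_Q (a *: x) = quot_scale a (\pi_Q x).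
Proof.
rewrite /quot_scale; unlock; apply/eqP; rewrite -Quotient.idealrBE -scalerBr.
rewrite -[_ \in _]/(_ \in I) rpredZ // -[_ \in _]/(_ \in submod_pred).
by rewrite Quotient.idealrBE reprK.
Qed.

Lemma quot_scaleA a b v : quot_scale a (quot_scale b v) = quot_scale (a * b) v.
Proof. by rewrite -[v]reprK -!pi_scale scalerA. Qed.

Lemma quot_scale1 : left_id 1 quot_scale.
Proof. by move=> v; rewrite -[v]reprK -pi_scale scale1r. Qed.

Lemma quot_scaleDr : right_distributive quot_scale +%R.
Proof.
move=> a u v; rewrite -[u]reprK -[v]reprK -(raddfD \pi_Q) -!pi_scale.
by rewrite scalerDr raddfD.
Qed.

Lemma quot_scaleDl v : {morph quot_scale^~ v : a b / a + b}.
Proof. by move=> a b; rewrite -[v]reprK -!pi_scale scalerDl raddfD. Qed.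

HB.instance Definition _ :=
  GRing.Zmodule_isLmodule.Build K Q quot_scaleA quot_scale1 quot_scaleDr quot_scaleDl.

End QuotientModule.

Definition finite_dim (K : fieldType) (V : lmodType K) :=
  exists (n : nat) (e : 'I_n -> V),
    forall v : V, exists c : 'I_n -> K, v = \sum_(i < n) c i *: e i.

Definition infinite_dim (K : fieldType) (V : lmodType K) := ~ finite_dim V.


Lemma bounded_funP (R : realType) (T : Type) (f : T -> R) :
  bounded_fun f <-> exists M : R, forall x, `|f x| <= M.
Proof.
split=> [/pinfty_ex_gt0[M _ fM]|[M fM]]; first by exists M => x; apply: fM.
exists M; split=> [|N /ltW MN x _ /=]; first exact: num_real.
exact: le_trans (fM x) MN.
Qed.

Section BoundedCohomology.
Variables (R : realType) (X : rackType).

Definition bounded_cochain n : {pred ('I_n -> X) -> R} :=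
  fun f => `[< bounded_fun f >].
Arguments bounded_cochain n f : clear implicits.

Lemma bounded_cochain_submod n : submod_closed (bounded_cochain n).
Proof.
split=> [|a f g /asboolP/bounded_funP[M fM] /asboolP/bounded_funP[N gN]].
  by apply/asboolP/bounded_funP; exists 0 => x; rewrite normr0.
apply/asboolP/bounded_funP; exists (`|a| * M + N) => x.
by rewrite (le_trans (ler_normD _ _))// lerD// normrM ler_wpM2l.
Qed.

HB.instance Definition _ n :=
  GRing.isSubmodClosed.Build R (('I_n -> X) -> R) (bounded_cochain n)
    (GRing.submod_closed_semi (bounded_cochain_submod n)).

Record cochains n := Cochain {
  cochain :> ('I_n -> X) -> R; _ : cochain \in bounded_cochain n }.

HB.instance Definition _ n := [isSub for @cochain n].
HB.instance Definition _ n := [Choice of cochains n by <:].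
HB.instance Definition _ n := [SubChoice_isSubLmodule of cochains n by <:].

(* Positions are counted from 0: x 0, ..., x n stand for x_1, ..., x_{n+1}.    *)
(* face0 i drops x i; face1 i moreover acts by x i on the entries before it.   *)
Definition face0 n (i : 'I_n.+1) (x : 'I_n.+1 -> X) : 'I_n -> X :=
  fun j => x (lift i j).

Definition face1 n (i : 'I_n.+1) (x : 'I_n.+1 -> X) : 'I_n -> X :=
  fun j => if (j < i)%N then (x (lift i j) ◁ x i)%rack else x (lift i j).

Definition face n (b : bool) := if b then @face1 n else @face0 n.

Lemma faceE n b (i : 'I_n.+1) x j :
  face b i x j =
  if b && (j < i)%N then (x (lift i j) ◁ x i)%rack else x (lift i j).
Proof. by case: b. Qed.

Lemma face_face n a b (i k : 'I_n.+2) (i' k' : 'I_n.+1) x :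
  (i < k)%N -> k = lift i k' -> i = lift k i' ->
  face a k' (face b i x) = face b i' (face a k x).
Proof.
move=> ik kE iE; apply/funext => l; rewrite !faceE -kE -iE.
have [vk vi] : k = k'.+1 :> nat /\ i = i' :> nat.
  by move: (congr1 val kE) (congr1 val iE); rewrite /= /bump; lia.
have <- : lift i (lift k' l) = lift k (lift i' l).
  by apply/val_inj; rewrite /= /bump; lia.
have -> : (k' < i)%N = false by lia.
have -> : (i' < k)%N by lia.
have -> : (lift k' l < i)%N = (l < i')%N by rewrite /= /bump; lia.
have -> : (lift i' l < k)%N = (l < k')%N by rewrite /= /bump; lia.
rewrite andbF; have [li|] := boolP (l < i')%N.
  have -> : (l < k')%N by lia.
  by case: a b => -[]; rewrite //= rack_opD.
by rewrite !andbF.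
Qed.

Definition coboundary_fun n (f : ('I_n -> X) -> R) (x : 'I_n.+1 -> X) : R :=
  \sum_(i < n.+1) (-1) ^+ i.+1 * (f (face0 i x) - f (face1 i x)).

Lemma coboundary_bounded n (f : cochains n) :
  coboundary_fun f \in bounded_cochain n.+1.
Proof.
case: f => f /= /asboolP/bounded_funP[M fM].
apply/asboolP/bounded_funP; exists (\sum_(i < n.+1) (M + M)) => x.
apply: le_trans (ler_norm_sum _ _ _) _; apply: ler_sum => i _.
by rewrite normrM normrX normrN1 expr1n mul1r (le_trans (ler_normB _ _))// lerD.
Qed.

Definition coboundary n (f : cochains n) : cochains n.+1 :=
  Cochain (coboundary_bounded f).

Lemma coboundary_linear n : linear (@coboundary n).
Proof.
move=> a f g; apply/val_inj/funext => x /=.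
rewrite /coboundary_fun !fctE scaler_sumr -big_split /=; apply: eq_bigr => i _.
by rewrite scalerAr scalerBr mulrDr -?mulrDr; congr (_ * _); rewrite addrACA -opprD.
Qed.

HB.instance Definition _ n :=
  GRing.isLinear.Build R (cochains n) (cochains n.+1) _ (@coboundary n)
    (@coboundary_linear n).

Lemma coboundary_coboundary n (f : cochains n) :
  coboundary (coboundary f) = 0.
Proof.
apply/val_inj/funext => x; rewrite /= /coboundary_fun.
pose h (i : 'I_n.+2) (j : 'I_n.+1) :=
  f (face false j (face false i x)) - f (face true j (face false i x)) -
  (f (face false j (face true i x)) - f (face true j (face true i x))).
pose G (i k : 'I_n.+2) : R :=
  if unlift i k is Some j then (-1) ^+ i.+1 * ((-1) ^+ j.+1 * h i j) else 0.
have GE i : \sum_k G i k = \sum_(j < n.+1) (-1) ^+ i.+1 * ((-1) ^+ j.+1 * h i j).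
  rewrite (bigD1_ord i)//= {1}/G unlift_none add0r.
  by apply: eq_bigr => j _; rewrite /G liftK.
have GN i k : G i k = - G k i.
  wlog ik : i k / (i < k)%N.
    move=> W; have [|/W->|/val_inj->] := ltngtP i k; first exact: W.
      by rewrite opprK.
    by rewrite /G unlift_none oppr0.
  rewrite /G; case: unliftP => [k' kE|ki]; last by rewrite ki ltnn in ik.
  case: unliftP => [i' iE|ki]; last by rewrite ki ltnn in ik.
  have -> : h i k' = h k i'.
    rewrite /h !(face_face _ _ _ ik kE iE) !opprB !addrA.
    by rewrite [LHS]addrAC [in RHS]addrAC; ring.
  have [-> ->] : k = k'.+1 :> nat /\ i = i' :> nat.
    by move: (congr1 val kE) (congr1 val iE); rewrite /= /bump; lia.
  by rewrite !exprS; ring.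
have -> : \sum_(i < n.+2) (-1) ^+ i.+1 *
    (coboundary_fun f (face0 i x) - coboundary_fun f (face1 i x)) =
    \sum_i \sum_k G i k.
  apply: eq_bigr => i _; rewrite GE -sumrB mulr_sumr.
  by apply: eq_bigr => j _; rewrite -mulrBr.
have S0 : \sum_i \sum_k G i k = - \sum_i \sum_k G i k.
  rewrite {1}exchange_big -sumrN; apply: eq_bigr => i _.
  by rewrite -sumrN; apply: eq_bigr => k _; rewrite GN.
by move: S0; set S := (\sum_i _) => S0; apply: (_ : S = 0); lra.
Qed.

(* In degree 0 the formula gives the zero map.                                 *)
Lemma coboundary0 (f : cochains 0) : coboundary f = 0.
Proof.
apply/val_inj/funext => x; rewrite /= /coboundary_fun big_ord1.
have -> : face0 ord0 x = face1 ord0 x by apply/funext; case.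
by rewrite subrr mulr0.
Qed.

Lemma coboundary1 (f : cochains 1) (x : 'I_2 -> X) :
  coboundary f x = f (fun=> x ord0) - f (fun=> (x ord0 ◁ x ord_max)%rack).
Proof.
rewrite /= /coboundary_fun big_ord_recl big_ord1.
have -> : face0 ord0 x = face1 ord0 x by apply/funext.
rewrite subrr mulr0 add0r expr2 mulN1r opprK mul1r; congr (f _ - f _);
  apply/funext => j; rewrite /face0 /face1 (ord1 j) /=.
  by congr x; apply/val_inj.
by congr (x _ ◁ x _)%rack; apply/val_inj.
Qed.

Definition cocycle n : {pred cochains n} := fun f => coboundary f == 0.
Arguments cocycle n f : clear implicits.

Lemma cocycle_submod n : submod_closed (cocycle n).
Proof.
split=> [|a f g]; rewrite !unfold_in ?linear0// => /eqP df /eqP dg.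
by apply/eqP; rewrite coboundary_linear df dg scaler0 addr0.
Qed.

HB.instance Definition _ n :=
  GRing.isSubmodClosed.Build R (cochains n) (cocycle n) (GRing.submod_closed_semi (cocycle_submod n)).

Record cocycles n := Cocycle {
  cocycle_val :> cochains n; _ : cocycle_val \in cocycle n }.

HB.instance Definition _ n := [isSub for @cocycle_val n].
HB.instance Definition _ n := [Choice of cocycles n by <:].
HB.instance Definition _ n := [SubChoice_isSubLmodule of cocycles n by <:].

(* The image of the previous coboundary map, which is zero when n = 0.         *)
Definition is_coboundary n : {pred cocycles n} :=
  match n return {pred cocycles n} with
  | 0 => fun f => f == 0
  | m.+1 => fun f => `[< exists g : cochains m, cocycle_val f = coboundary g >]
  end.
Arguments is_coboundary n f : clear implicits.

Lemma is_coboundary_submod n : submod_closed (is_coboundary n).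
Proof.
case: n => [|n]; split; rewrite ?unfold_in//.
- by move=> a f g; rewrite !unfold_in => /eqP-> /eqP->; rewrite scaler0 addr0.
- by apply/asboolP; exists 0; rewrite linear0.
move=> a f g; rewrite !unfold_in => /asboolP[u fu] /asboolP[v gv].
by apply/asboolP; exists (a *: u + v); rewrite coboundary_linear -fu -gv.
Qed.

HB.instance Definition _ n :=
  GRing.isSubmodClosed.Build R (cocycles n) (is_coboundary n)
    (GRing.submod_closed_semi (is_coboundary_submod n)).

Definition bounded_cohomology n : lmodType R :=
  quot_module (is_coboundary n).

End BoundedCohomology.

(* Main.v *)
(** A function [f] on a rack such that [f x - f (x ◁ y)] is bounded yields a
bounded 2-cocycle, which is the coboundary of a bounded function only if [f]
differs from a bounded function by one that is constant on orbits. If [phi] is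
an antisymmetric quasimorphism of the free group, then
[phi (g h^-1 t h)] is [phi g] up to a bounded error, so [f (s, g) = phi g] is
such a function. Fix two generators [a], [b]. The Brooks quasimorphisms
counting [a b^k a] minus its inverse are linearly independent modulo bounded
functions: only the one with [k = j] is unbounded on the powers of [a b^j]. *)
Require Import Defs.
From mathcomp Require Import all_boot all_order all_algebra.
From mathcomp Require Import zify ring lra.
From mathcomp Require Import all_classical all_reals all_analysis.

Set Implicit Arguments.
Unset Strict Implicit.
Unset Printing Implicit Defensive.

Import Order.TTheory GRing.Theory Num.Theory.

Local Open Scope ring_scope.

(** * Counting occurrences of a subword *)

Section Occurrences.
Variable T : eqType.
Implicit Types u v w : seq T.

Fixpoint occ u w : nat :=
  if w is _ :: w' then (prefix u w + occ u w')%N else 0%N.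

Lemma occ_cons u x w : occ u (x :: w) = (prefix u (x :: w) + occ u w)%N.
Proof. by []. Qed.

Lemma occ_le_size u w : (occ u w <= size w)%N.
Proof.
by elim: w => // x w IHw; rewrite occ_cons; apply: leq_add (leq_b1 _) IHw.
Qed.

Lemma occ_cat_ge u v w : (occ u v + occ u w <= occ u (v ++ w))%N.
Proof.
elim: v => // x v IHv; rewrite cat_cons !occ_cons -addnA leq_add //.
case: (boolP (prefix u (x :: v))) => // uv.
by rewrite -cat_cons prefix_catl.
Qed.

Lemma occ_cat_le u v w : (occ u (v ++ w) <= occ u v + occ u w + size u)%N.
Proof.
(* Strengthened for the induction on [v]: an occurrence across the junction starts in [v], among its
   last [size u] letters. *)
suff : (occ u (v ++ w) <= occ u v + occ u w + minn (size u) (size v))%N by lia.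
elim: v => [|x v IHv]; first by rewrite addnAC leq_addl.
rewrite cat_cons !occ_cons; have [uv|uv] := leqP (size u) (size v).+1.
  have -> : prefix u (x :: v ++ w) = prefix u (x :: v).
    by rewrite -cat_cons !prefixE takel_cat.
  by rewrite /=; lia.
by have := leq_b1 (prefix u (x :: v ++ w)); rewrite /=; lia.
Qed.

Lemma occ_notin u x w : x \in u -> x \notin w -> occ u w = 0%N.
Proof.
move=> xu; elim: w => // y w IHw; rewrite inE negb_or => /andP[xy xw].
rewrite occ_cons IHw // addn0; case: (boolP (prefix u (y :: w))) => //.
by case/prefixP=> s E; have := mem_cat x u s; rewrite -E xu inE (negPf xy) (negPf xw).
Qed.

Definition loop_word (a b : T) k := a :: rcons (nseq k b) a.

Definition power_word (a b : T) j N := flatten (nseq N (a :: nseq j b)).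

(** Occurrences start only at an [a], and one starting there needs the following block of [b] to
    have length [k] and to be closed by another [a]. The last of the [N.+1] blocks has no closing
    [a], whence [N]. *)
Lemma occ_power_word (a b : T) j k N : a != b ->
  occ (loop_word a b k) (power_word a b j N.+1) = (N * (j == k))%N.
Proof.
move=> ab.
have skip i w : occ (loop_word a b k) (nseq i b ++ w) = occ (loop_word a b k) w.
  by elim: i => //= i ->; rewrite (negPf ab).
have match_block w :
    prefix (rcons (nseq k b) a) (nseq j b ++ w) = 
    if (j <= k)%N then prefix (rcons (nseq (k - j) b) a) w else false.
  elim: j k {skip} => [|j IHj] [|k] //=; first by rewrite (negPf ab).
  by rewrite eqxx /= IHj.
elim: N => [|N IHN].
  rewrite /power_word /= cats0 eqxx /= -[nseq j b]cats0 skip addn0.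
  rewrite match_block; case: ifP => // jk; case: (k - j)%N => [|i] //.
rewrite -[power_word _ _ _ N.+2]/((a :: nseq j b) ++ power_word a b j N.+1).
rewrite /= skip IHN eqxx /= match_block mulSn; congr (_ + _)%N.
have [jk|jk] := leqP j k; last by rewrite gtn_eqF.
rewrite /power_word /=; have [->|] := eqVneq j k.
  by rewrite subnn /= eqxx prefix0s.
by case: (k - j)%N (subn_eq0 k j) => [|i] //= *; [lia|rewrite eq_sym (negPf ab)].
Qed.

End Occurrences.

(** * Cancellation in products of reduced words *)

Section Words.
Variable S : choiceType.
Implicit Types v w : seq (S * bool).

Lemma word_inv_cat v w : word_inv (v ++ w) = word_inv w ++ word_inv v.
Proof. by rewrite /word_inv map_cat rev_cat. Qed.

(** Induction on [v]: a new first letter can cancel only when [p] is empty, since otherwise its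
    neighbour lies in the reduced word [v]. *)
Lemma word_mul_cancel v w : reduced v -> exists p q r,
  [/\ v = p ++ q, w = word_inv q ++ r & word_mul v w = p ++ r].
Proof.
elim: v => [_|x v IHv xv]; first by exists [::], [::], w.
have [p [q [r [vE wE vwE]]]] := IHv (path_sorted xv).
rewrite /= vwE; case: p vE vwE => [|y p] vE vwE /=; last first.
  exists (x :: y :: p), q, r; split; rewrite ?vE //.
  by move: xv; rewrite vE /= => /andP[/negPf->].
case: r wE vwE => [|y r] wE vwE; first by exists [:: x], q, [::]; rewrite vE.
rewrite /letter_mul; case: ifP => [/eqP yE|_].
  exists [::], (x :: q), r; split; rewrite ?vE //.
  by rewrite wE yE -[x :: q]cat1s word_inv_cat -catA.
by exists [:: x], q, (y :: r); rewrite vE.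
Qed.

Lemma reduced_positive w : all (fun x => ~~ x.2) w -> reduced w.
Proof.
elim: w => // x [//|y w] IHw /= /and3P[x2 y2 w2].
rewrite /reduced /= in IHw *; rewrite IHw ?y2 // andbT.
by apply: contra y2 => /eqP->.
Qed.

End Words.

(** * Brooks quasimorphisms *)

Section Brooks.
Variables (R : realType) (S : choiceType).
Implicit Types v w : seq (S * bool).

(** Subtracting the count in the inverse word, rather than the count of the
inverse of [u], makes antisymmetry immediate. *)
Definition brooks u w : R := (occ u w)%:R - (occ u (word_inv w))%:R.

Lemma brooks_inv u w : brooks u (word_inv w) = - brooks u w.
Proof. by rewrite /brooks word_invK opprB. Qed.

Lemma brooks_cat u v w :
  `|brooks u (v ++ w) - brooks u v - brooks u w| <= (size u)%:R.
Proof.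
rewrite /brooks word_inv_cat ler_norml.
have := occ_cat_ge u v w; have := occ_cat_le u v w.
have := occ_cat_ge u (word_inv w) (word_inv v).
have := occ_cat_le u (word_inv w) (word_inv v).
rewrite -!(ler_nat R) !natrD => *; apply/andP; split; lra.
Qed.

Lemma brooks_mul u (g h : free_group S) :
  `|brooks u (g * h)%g - brooks u g - brooks u h| <= 3 * (size u)%:R.
Proof.
have [p [q [r [gE hE ghE]]]] := word_mul_cancel h (valP g).
rewrite -[word (g * h)%g]/(word_mul g h) ghE [word g]gE [word h]hE.
(* One error [size u] for each of the three concatenations; the contributions of [q] cancel by
   antisymmetry. *)
have := brooks_cat u p r; have := brooks_cat u p q.
have := brooks_cat u (word_inv q) r; rewrite brooks_inv !ler_norml.
by move=> /andP[? ?] /andP[? ?] /andP[? ?]; apply/andP; split; lra.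
Qed.

Lemma brooks_conj_bounded u : exists M : R, forall x y : free_rack S,
  `|brooks u x.2 - brooks u (x ◁ y)%rack.2| <= M.
Proof.
(* Three products cost [3 * size u] each and the generator at most 1; the values at [h] and its
   inverse cancel. *)
exists (9 * (size u)%:R + 1) => -[s g] [t h].
have -> : (((s, g) : free_rack S) ◁ (t, h))%rack = (s, g * h^-1 * fg_gen t * h)%g.
  by [].
have := brooks_mul u (g * h^-1 * fg_gen t)%g h.
have := brooks_mul u (g * h^-1)%g (fg_gen t).
have := brooks_mul u g h^-1%g.
rewrite -[word h^-1%g]/(word_inv h) brooks_inv.
have : `|brooks u (fg_gen t)| <= 1.
  have g1 : (occ u (fg_gen t) <= 1)%N := occ_le_size _ _.
  have gV1 : (occ u (word_inv (fg_gen t)) <= 1)%N := occ_le_size _ _.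
  have := ler0n R (occ u (fg_gen t)); have := ler0n R (occ u (word_inv (fg_gen t))).
  move: g1 gV1; rewrite -!(ler_nat R) /brooks ler_norml => *.
  by apply/andP; split; lra.
rewrite /= !ler_norml.
by move=> /andP[? ?] /andP[? ?] /andP[? ?] /andP[? ?]; apply/andP; split; lra.
Qed.

Lemma power_word_positive (a b : S) j N :
  all (fun x => ~~ x.2) (power_word (a, false) (b, false) j N).
Proof. by elim: N => //= N; rewrite all_cat all_nseq orbT. Qed.

Lemma brooks_power_word (a b : S) j k N : a != b ->
  brooks (loop_word (a, false) (b, false) k)
    (power_word (a, false) (b, false) j N.+1) = (N * (j == k))%:R.
Proof.
move=> ab; rewrite /brooks occ_power_word; last by apply: contra ab => /eqP[->].
(* The inverse of a positive word has only negative letters, so its count is zero. *)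
rewrite (@occ_notin _ _ (a, false)) ?subr0 ?mem_head // mem_rev.
apply/mapP => -[x xw /(congr1 snd) /= x2].
by have := allP (power_word_positive a b j N.+1) x xw; rewrite -x2.
Qed.

End Brooks.

(** * Linear relations in finite dimension *)

Section LinearDependence.
Variable K : fieldType.

Lemma finite_dim_dependent (V : lmodType K) : finite_dim V ->
  exists n, forall v : 'I_n -> V, exists d : 'I_n -> K,
    (exists i, d i != 0) /\ \sum_(i < n) d i *: v i = 0.
Proof.
move=> [n [e eV]]; exists n.+1 => v.
have [c cE] := choice (fun i => eV (v i)).
pose C := \matrix_(i < n.+1, j < n) c i j.
(* The coordinate matrix has more rows than columns, and a vector of its left kernel is a
   relation. *)
have : kermx C != 0.
  rewrite kermx_eq0; apply/negP => /eqP rC.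
  by have := rank_leq_col C; rewrite rC ltnn.
case/rowV0Pn=> d /sub_kermxP dC d0; exists (d ord0); split.
  by apply/rV0Pn.
under eq_bigr => i _ do rewrite cE scaler_sumr.
rewrite exchange_big big1 //= => j _.
under eq_bigr => i _ do rewrite scalerA.
rewrite -scaler_suml; move/matrixP/(_ ord0 j): dC; rewrite !mxE => dC.
under eq_bigr => i _ do (rewrite (_ : c i j = C i j); last by rewrite mxE).
by rewrite dC scale0r.
Qed.

End LinearDependence.

(** * Bounded cocycles from unbounded functions *)

Section DefectCocycles.
Variables (R : realType) (X : rackType).

(** The cocycle is the formal coboundary of [f]. As [f] may be unbounded, [coboundary_coboundary]
    does not apply, and the identity is checked directly from self-distributivity. *)
Lemma defect_cocycle (f : X -> R) (M : R) :
    (forall x y, `|f x - f (x ◁ y)%rack| <= M) ->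
  exists z : cocycles R X 2,
    forall x, z x = f (x ord0) - f (x ord0 ◁ x ord_max)%rack.
Proof.
move=> fM; pose F (x : 'I_2 -> X) := f (x ord0) - f (x ord0 ◁ x ord_max)%rack.
have bF : F \in @bounded_cochain R X 2.
  by apply/asboolP/Defs.bounded_funP; exists M => x; apply: fM.
suff cF : Cochain bF \in @cocycle R X 2 by exists (Cocycle cF).
apply/eqP/val_inj/funext => x.
(* Indexing by [nat] lets the lifted positions compute to numerals. *)
have [y ->] : exists y : nat -> X, x = fun i => y i.
  by exists (x \o inord); apply/funext => i; rewrite /= inord_val.
rewrite /= /coboundary_fun !big_ord_recl big_ord0 addr0 /F /face0 /face1 /=.
rewrite /bump /= !(addn0, add0n, addn1) (rack_opD (y 0%N)) -[RHS]/(0 : R).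
by ring.
Qed.

(** The second hypothesis is independence of the [f k] modulo bounded functions plus functions
    constant on orbits, which is what a relation between the classes would violate. *)
Lemma infinite_dim_bounded_cohomology2 (f : nat -> X -> R) :
    (forall k, exists M : R, forall x y, `|f k x - f k (x ◁ y)%rack| <= M) ->
    (forall n (d : 'I_n -> R) (g : X -> R) (M : R), (forall x, `|g x| <= M) ->
      (forall x y, \sum_(i < n) d i * f i x - g x =
                   \sum_(i < n) d i * f i (x ◁ y)%rack - g (x ◁ y)%rack) ->
      forall i, d i = 0) ->
  infinite_dim (bounded_cohomology R X 2).
Proof.
move=> fM indep /finite_dim_dependent[n dep].
have /choice[z zE] k : exists z : cocycles R X 2,
    forall x, z x = f k (x ord0) - f k (x ord0 ◁ x ord_max)%rack.
  by have [M kM] := fM k; apply: defect_cocycle kM.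
pose Q := bounded_cohomology R X 2.
have [d [[i di0] dz]] := dep (fun i => \pi_Q%qT (z i)).
have {}dz : \pi_Q%qT (\sum_(i < n) d i *: z i) = 0.
  rewrite -dz raddf_sum; apply: eq_bigr => k _; exact: pi_scale.
have : \sum_(i < n) d i *: z i \in @is_coboundary R X 2.
  rewrite -[_ \in _]/(_ \in submod_pred _) -[X in X \in _]subr0.
  by rewrite Quotient.idealrBE; apply/eqP; rewrite raddf0.
rewrite unfold_in => /asboolP[g gE].
pose h (x : X) := g (fun=> x); suff : d i = 0 by move/eqP; rewrite (negPf di0).
have /asboolP/Defs.bounded_funP[M gM] := valP g.
apply: (indep n d h M) => [x|x y]; first exact: gM.
pose xy (k : 'I_2) := if k == ord0 then x else y.
have := congr1 (fun c => cochain c xy) gE; rewrite coboundary1 /=.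
have -> : cocycle_val (\sum_(k < n) d k *: z k) xy =
    \sum_(k < n) (d k * f k x - d k * f k (x ◁ y)%rack).
  rewrite (big_morph (fun c : cocycles R X 2 => c xy) (id1 := 0) (op1 := +%R)) //.
  by apply: eq_bigr => k _; rewrite -mulrBr -[RHS]/(d k * (_ - _)) -(zE k xy).
by rewrite sumrB /h /xy /=; lra.
Qed.

End DefectCocycles.

(** Since (s, g) ◁ (t, g) = (s, t g), the component of s is a single orbit. *)
Lemma free_rack_invariant (S : choiceType) (T : Type) (F : free_rack S -> T) :
    (forall x y, F (x ◁ y)%rack = F x) ->
  forall s g, F (s, g) = F (s, 1%g).
Proof.
move=> FD s.
have Fgen t (g : free_group S) : F (s, (fg_gen t * g)%g) = F (s, g).
  by rewrite -(FD (s, g) (t, g)); congr (F (s, _)); rewrite /= mulgV mul1g.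
have FgenV t (g : free_group S) : F (s, ((fg_gen t)^-1 * g)%g) = F (s, g).
  by rewrite -(Fgen t (_ * g)%g) mulgA mulgV mul1g.
case=> w; elim: w => [|[t b] w IHw] rw.
  by congr (F (s, _)); apply: val_inj.
rewrite -(IHw (path_sorted rw)).
have mulE : letter_mul (t, b) w = (t, b) :: w.
  by case: w rw {IHw} => //= y w /andP[/negPf->].
pose g := FreeGroup (path_sorted rw).
have [E|E] : FreeGroup rw = (fg_gen t * g)%g \/ FreeGroup rw = ((fg_gen t)^-1 * g)%g.
- by case: b rw @g mulE => rw g mulE; [right | left]; apply: val_inj.
- by rewrite E Fgen.
- by rewrite E FgenV.
Qed.

Theorem corollary1p2 (R : realType) (S : finType) (hS : (2 <= #|S|)%N) :
  infinite_dim (bounded_cohomology R (free_rack S) 2).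
Proof.
have /card_gt1P[a [b [_ _ ab]]] := hS.
pose u k := loop_word (a, false) (b, false) k.
pose f k (x : free_rack S) : R := brooks R (u k) x.2.
apply: (infinite_dim_bounded_cohomology2 (f := f)) => [k|n d g M gM inv i].
  exact: brooks_conj_bounded.
pose F x := \sum_(k < n) d k * f k x - g x.
have FE := free_rack_invariant (F := F) (fun x y => esym (inv x y)) a.
(* On [N.+1] blocks [a b^i] only the term [k = i] survives, with value [d i * N]; at the identity
   every term vanishes. Invariance of [F] turns this into a difference of two values of [g]. *)
have dN N : `|d i| * N%:R <= M + M.
  pose w := FreeGroup (reduced_positive (power_word_positive a b i N.+1)).
  have dE : \sum_(k < n) d k * f k (a, w) = d i * N%:R.
    rewrite (bigD1 i) //= big1 => [|k ki].
      by rewrite /f brooks_power_word // eqxx muln1 addr0.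
    by rewrite /f brooks_power_word // (_ : (i == k :> nat) = false) ?muln0 ?mulr0 // eq_sym; apply: negPf ki.
  have := FE w; rewrite /F dE [X in _ = X - _]big1 => [E|k _]; last first.
    by rewrite /f /brooks /= subrr mulr0.
  have -> : `|d i| * N%:R = `|g (a, w) - g (a, 1%g)|.
    by rewrite -[N%:R in LHS]ger0_norm // -normrM; congr `|_|; lra.
  by rewrite (le_trans (ler_normB _ _)) // lerD.
apply/eqP; rewrite -normr_le0 leNgt; apply/negP => di0.
have M0 : 0 <= (M + M) / `|d i|.
  by rewrite divr_ge0 // (le_trans _ (dN 0%N)) // mulr0.
(* An integer [N] beyond [(M + M) / |d i|] contradicts [dN]. *)
by have := archi_boundP M0; rewrite ltr_pdivrMr // mulrC ltNge dN.
Qed.
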